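(* Let $H$ be a uniformly random directed hypergraph with degree sequence $((d_v^{\mathrm{out}},d_v^{\mathrm{in}})_{v\in V},(\delta_e^{\mathrm{tail}},\delta_e^{\mathrm{head}})_{e\in E})$, where $n=|V|$, and let $DH_n$ be its number of degenerate hyperedges. Then $$\mathbb{E}[DH_n] = |E| - \sum_{e \in E} \frac{\delta_e^{\mathrm{tail}}!\,\delta_e^{\mathrm{head}}!\,(n\mathbb{E}[d_U^{\mathrm{out}}]-\delta_e^{\mathrm{tail}})!\,(n\mathbb{E}[d_U^{\mathrm{in}}]-\delta_e^{\mathrm{head}})!}{(n\mathbb{E}[d_U^{\mathrm{out}}])!\,(n\mathbb{E}[d_U^{\mathrm{in}}])!}$$ $$\times \sum_{\substack{\mathbf{a} \in \mathbb{N}^{\delta_e^{\mathrm{tail}}}:\\ \sum_{i}ia_i= \delta_e^{\mathrm{tail}}}} (-1)^{\sum_{i=1}^{\delta_e^{\mathrm{tail}}}(i-1)a_i} \prod_{i=1}^{\delta_e^{\mathrm{tail}}} \left( \frac{1}{a_i!}\left(\frac{n\mathbb{E}[(d_U^{\mathrm{out}})^i]}{i}\right)^{a_i} \right)$$ $$\times\sum_{\substack{\mathbf{b} \in \mathbb{N}^{\delta_e^{\mathrm{head}}}:\\ \sum_{i}ib_i = \delta_e^{\mathrm{head}}}} (-1)^{\sum_{i=1}^{\delta_e^{\mathrm{head}}}(i-1)b_i} \prod_{i=1}^{\delta_e^{\mathrm{head}}} \left( \frac{1}{b_i!}\left(\frac{n\mathbb{E}[(d_U^{\mathrm{in}})^i]}{i}\right)^{b_i}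 \right).$$
   Context: $\mathbb{N}$ contains $0$, and $0^0=1$. Let $V$ be a finite vertex set with $n=|V|$ and $E$ a finite set of (labelled) hyperedges. A directed degree sequence consists of vertex out- and in-degrees $d_v^{\mathrm{out}},d_v^{\mathrm{in}}\in\mathbb{N}$ ($v\in V$) and hyperedge tail- and head-degrees $\delta_e^{\mathrm{tail}},\delta_e^{\mathrm{head}}\in\mathbb{N}$ ($e\in E$) with $\sum_v d_v^{\mathrm{out}}=\sum_e\delta_e^{\mathrm{tail}}$ and $\sum_v d_v^{\mathrm{in}}=\sum_e\delta_e^{\mathrm{head}}$. A uniformly random (stub-labeled) directed hypergraph with this degree sequence is obtained as follows: each vertex $v$ has $d_v^{\mathrm{out}}$ distinguishable out-stubs and $d_v^{\mathrm{in}}$ distinguishable in-stubs; all out-stubs are distributed over the tails so that the tail of $e$ receives exactly $\delta_e^{\mathrm{tail}}$ out-stubs, and all in-stubs are distributed over the heads so that the head of $e$ receives exactly $\delta_e^{\mathrm{head}}$ in-stubs (slots within a tail or head are interchangeable); all such pairs of assignments are equally likely (so the out- and in-assignments are independent and uniform). Each hyperedge is then a pair $e=(e^{\mathrm{tail}},e^{\mathrm{head}})$ of multisets of vertices, where $m_v(e^{\mathrm{tail}})$ and $m_v(e^{\mathrm{head}})$ count the stubs of $v$ in the tail and in the head. A hyperedge $e$ is degenerate if there is $v\in V$ with $m_v(e^{\mathrm{tail}})\ge 2$ or $m_v(e^{\mathrm{head}})\ge2$; $DH_n$ is the number of degenerate hyperedges. $U$ is a uniformly chosen vertex of $V$, with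 out-degree $d_U^{\mathrm{out}}$ and in-degree $d_U^{\mathrm{in}}$. *)

(* Defs.v *)
From mathcomp Require Import all_boot all_order all_algebra.

Set Implicit Arguments.
Unset Strict Implicit.
Unset Printing Implicit Defensive.

Import Order.TTheory GRing.Theory Num.Theory.
Local Open Scope ring_scope.

(* Expectation of X under the uniform distribution on A. *)
Definition expect (R : numFieldType) (T : finType) (A : {set T}) (X : T -> R) : R :=
  (\sum_(x in A) X x) / #|A|%:R.

(* x! for an x : R that is a natural number. *)
Definition factr (R : archiRealFieldType) (x : R) : R := ((Num.truncn x)`!)%:R.

Lemma factr_nat (R : archiRealFieldType) (n : nat) : factr n%:R = (n`!)%:R :> R.
Proof. by rewrite /factr natrK. Qed.

Section Hypergraph.
Variables V E : finType.

(* The k-th stub of v is Tagged _ k, with k < d v. *)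
Definition stub (d : V -> nat) : finType := {v : V & 'I_(d v)}.

(* A distribution of the stubs is the map sending a stub to the hyperedge whose
   tail (or head) receives it: the slots inside a tail or head are not ordered. *)
Definition assignments (d : V -> nat) (delta : E -> nat) :
    {set {ffun stub d -> E}} :=
  [set f : {ffun stub d -> E} | [forall e, #|[set s | f s == e]| == delta e]].

Definition dihypergraphs (dout din : V -> nat) (dtail dhead : E -> nat) :
    {set {ffun stub dout -> E} * {ffun stub din -> E}} :=
  setX (assignments dout dtail) (assignments din dhead).

(* Multiplicity of v in the multiset of vertices that f puts in e. *)
Definition mult (d : V -> nat) (f : {ffun stub d -> E}) (e : E) (v : V) : nat :=
  #|[set s | (f s == e) && (tag s == v)]|.

Definition degenerate (dout din : V -> nat)
    (H : {ffun stub dout -> E} * {ffun stub din -> E}) (e : E) : bool :=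
  [exists v, (2 <= mult H.1 e v)%N || (2 <= mult H.2 e v)%N].

Definition DH (dout din : V -> nat)
    (H : {ffun stub dout -> E} * {ffun stub din -> E}) : nat :=
  #|[set e | degenerate H e]|.

End Hypergraph.

(* The vectors (a_1, ..., a_k) of naturals with \sum_i i * a_i = k. The
   coordinate a_i is a (i - 1) here, and it is bounded by k, see
   weighted_vectorsE. *)
Definition weighted_vectors (k : nat) : {set {ffun 'I_k -> 'I_k.+1}} :=
  [set a : {ffun 'I_k -> 'I_k.+1} | (\sum_(i < k) i.+1 * a i == k)%N].

Lemma weighted_vectorsE (k : nat) (a : 'I_k -> nat) :
  (\sum_(i < k) i.+1 * a i = k)%N <->
  exists2 b, b \in weighted_vectors k & forall i, a i = b i.
Proof.
split=> [ha | [b hb hab]]; last first.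
  move: hb; rewrite inE => /eqP hb; rewrite -[RHS]hb.
  by apply: eq_bigr => i _; rewrite hab.
have a_lt i : (a i < k.+1)%N.
  by rewrite ltnS -[leqRHS]ha (bigD1 i) //= mulSn -addnA leq_addr.
exists [ffun i => Ordinal (a_lt i)]; last by move=> i; rewrite ffunE.
rewrite inE; apply/eqP; rewrite -[RHS]ha.
by apply: eq_bigr => i _; rewrite ffunE.
Qed.

(* Main.v *)
Require Import Defs.
From mathcomp Require Import all_boot all_order all_algebra.
From mathcomp Require Import fingroup perm ring.

Import Order.TTheory GRing.Theory Num.Theory.
Local Open Scope ring_scope.

(** By linearity E[DH_n] is |E| minus the sum over e of the probability that e is
    non-degenerate, and since the out- and in-assignments are independent this
    probability is a product of a tail factor and a head factor. It remains to
    compute, for stubs in numbers d v distributed with M stubs in total, the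
    probability that the k = delta e stubs received by e belong to k distinct
    vertices.

    Permuting the stubs preserves the uniform assignment, so the set of stubs
    received by e is a uniform k-subset of the M stubs
    ([card_fiber_pred]). A k-subset with at most one stub of each vertex is a
    choice of k vertices and of one stub of each, so that there are e_k(d) of
    them, where e_k(d) is the k-th elementary symmetric polynomial of the
    degrees, that is the coefficient of X^k in the product of the 1 + d v X
    ([coef_prod_card_transversal]). The probability is therefore
    e_k(d) k! (M - k)! / M!.

    Finally n E[d_U^i] is the i-th power sum of the degrees, and the sum over the
    vectors a is the expansion of e_k(d) in power sums given by
    exp (\sum_i (-1)^(i-1) p_i X^i / i) = \prod_v (1 + d v X)
    ([signed_cycle_indexE]). *)

(** * Truncated logarithmic derivatives *)

(** The congruence F' = C F modulo X^N, the order at which the coefficients of F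
    up to degree N are determined by C and by the constant term of F. It stands
    for C = F' / F, without requiring that F be invertible. *)
Definition log_deriv {R : fieldType} (N : nat) (F C : {poly R}) : bool :=
  'X^N %| F^`() - C * F.

Lemma log_deriv_prod {R : fieldType} {I : finType} (N : nat)
    (F C : I -> {poly R}) :
  (forall i, log_deriv N (F i) (C i)) ->
  log_deriv N (\prod_i F i) (\sum_i C i).
Proof.
move=> FC; elim/big_rec2: _ => [|i G D _ IH].
  by rewrite /log_deriv derivC mul0r subr0 dvdp0.
rewrite /log_deriv derivM.
have -> : (F i)^`() * D + F i * D^`() - (C i + G) * (F i * D) =
  ((F i)^`() - C i * F i) * D + F i * (D^`() - G * D) by ring.
by rewrite dvdp_add // ?(dvdp_mulr _ (FC i)) // dvdp_mull.
Qed.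

(** The congruence D' = C D modulo X^N reads k.+1 D_k.+1 = \sum_i C_i D_(k-i) for
    k < N, so D vanishes up to degree N as soon as its constant term does. *)
Lemma log_deriv_inj {R : numFieldType} (N : nat) (F G C : {poly R}) :
  log_deriv N F C -> log_deriv N G C -> F`_0 = G`_0 ->
  forall k, (k <= N)%N -> F`_k = G`_k.
Proof.
move=> hF hG FG0.
have /dvdpP [Q hQ] : 'X^N %| (F - G)^`() - C * (F - G).
  rewrite derivB.
  have -> : F^`() - G^`() - C * (F - G) =
    (F^`() - C * F) - (G^`() - C * G) by ring.
  by rewrite dvdp_sub.
suff D0 k : (k <= N)%N -> (F - G)`_k = 0.
  by move=> k /D0 /eqP; rewrite coefB subr_eq0 => /eqP.
elim/ltn_ind: k => -[|k] IH kN; first by rewrite coefB FG0 subrr.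
have /eqP : (F - G)^`()`_k = 0.
  have -> : (F - G)^`() = Q * 'X^N + C * (F - G) by rewrite -hQ subrK.
  rewrite coefD coefMXn kN add0r coefM big1 // => i _.
  by rewrite IH ?mulr0 ?ltnS ?leq_subr ?(leq_trans (leq_subr _ _) (ltnW kN)).
by rewrite coef_deriv mulrn_eq0 => /eqP.
Qed.

Definition exp_trunc {R : fieldType} (N : nat) (p : {poly R}) : {poly R} :=
  \sum_(j < N.+1) (j`!)%:R^-1 *: p ^+ j.

(** The derivative of the sum of the p^j / j! for j <= N is p' times the same sum
    without its last term, and that term is a multiple of X^N. *)
Lemma log_deriv_exp {R : numFieldType} (N : nat) (p : {poly R}) :
  'X %| p -> log_deriv N (exp_trunc N p) p^`().
Proof.
move=> Xp; rewrite /log_deriv /exp_trunc.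
rewrite raddf_sum big_ord_recl /= expr0 linearZ /= derivC scaler0 add0r.
have -> : \sum_(i < N) ((lift ord0 i)`!%:R^-1 *: p ^+ lift ord0 i)^`() =
   p^`() * \sum_(i < N) (i`!)%:R^-1 *: p ^+ i.
  rewrite mulr_sumr; apply: eq_bigr => i _.
  rewrite linearZ /= deriv_exp /= -scalerAr -scaler_nat scalerA; congr (_ *: _).
  rewrite factS natrM invfM mulrC mulrA divff ?mul1r //.
  by rewrite pnatr_eq0.
rewrite -mulrBr big_ord_recr /= opprD addNKr dvdp_mull // dvdpNr dvdpZr.
  exact: dvdp_exp2r.
by rewrite invr_eq0 pnatr_eq0 -lt0n fact_gt0.
Qed.

(** The geometric series expansion of x / (1 + x X). *)
Lemma log_deriv_linear {R : fieldType} (N : nat) (x : R) :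
  log_deriv N (1 + x *: 'X) (\sum_(i < N) ((-1) ^+ i * x ^+ i.+1) *: 'X^i).
Proof.
have -> : \sum_(i < N) ((-1) ^+ i * x ^+ i.+1) *: 'X^i =
          x%:P * \sum_(i < N) (- (x *: 'X)) ^+ i.
  rewrite mulr_sumr; apply: eq_bigr => i _.
  by rewrite -scaleNr exprZn mul_polyC scalerA [(- x) ^+ i]exprNn exprS mulrCA.
rewrite /log_deriv derivD derivC add0r derivZ derivX alg_polyC.
have -> : 1 + x *: 'X = - (- (x *: 'X) - 1) by rewrite opprB opprK.
rewrite mulrN -mulrA [_ * (- _ - 1)]mulrC -subrX1.
rewrite mulrBr mulr1 opprK addrCA subrr addr0 dvdp_mull //.
by apply: dvdp_exp2r; rewrite -scaleNr -mul_polyC dvdp_mull.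
Qed.

(** * Elementary symmetric polynomials in terms of power sums *)

(** This is the k-th elementary symmetric polynomial written in the power sums
    p 1, p 2, and so on: the cycle index of the symmetric group of degree k,
    where a i is the number of cycles of length i.+1, each counted with its
    sign. *)
Definition signed_cycle_index {R : numFieldType} (k : nat) (p : nat -> R) : R :=
  \sum_(a in weighted_vectors k)
     (-1) ^+ (\sum_(i < k) (i.+1 - 1) * a i)%N
     * \prod_(i < k) (((a i)`!)%:R^-1 * (p i.+1 / i.+1%:R) ^+ a i).

Lemma eq_signed_cycle_index {R : numFieldType} (k : nat) (p q : nat -> R) :
  p =1 q -> signed_cycle_index k p = signed_cycle_index k q.
Proof.
move=> pq; apply: eq_bigr => a _; congr (_ * _).
by apply: eq_bigr => i _; rewrite pq.
Qed.

(** As formal power series, the product of the 1 + x v X is the exponential of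
    the sum of the log (1 + x v X), in which X^i has the coefficient
    (-1)^(i-1) (\sum_v x v ^+ i) / i. Expanding this exponential as a product of
    one exponential for each power of X, and choosing the term of rank a i in
    the one that belongs to X^(i.+1), gives the cycle index. Both sides are compared through their logarithmic
    derivatives, which needs no logarithm. *)
Lemma signed_cycle_indexE {R : numFieldType} {V : finType} (x : V -> R) k :
  signed_cycle_index k (fun i => \sum_v x v ^+ i) =
  (\prod_v (1 + x v *: 'X))`_k.
Proof.
pose c (i : nat) : R := (-1) ^+ i * (\sum_v x v ^+ i.+1) / i.+1%:R.
pose p (i : nat) : {poly R} := c i *: 'X^(i.+1).
transitivity (\prod_(i < k) exp_trunc k (p i))`_k.
  rewrite /exp_trunc bigA_distr_bigA coef_sum /=.
  rewrite /signed_cycle_index [LHS]big_mkcond /=.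
  apply: eq_bigr => a _.
  have -> : \prod_(i < k) (((a i)`!)%:R^-1 *: p i ^+ a i) =
     (\prod_(i < k) (((a i)`!)%:R^-1 * c i ^+ a i))
     *: 'X^(\sum_(i < k) i.+1 * a i).
    rewrite [in RHS]expr_sum -scaler_prod; apply: eq_bigr => i _.
    by rewrite exprZn scalerA exprM.
  rewrite coefZ coefXn inE eq_sym; case: eqP => _; last by rewrite mulr0.
  rewrite mulr1 expr_sum -big_split /=; apply: eq_bigr => i _.
  by rewrite subn1 /= mulrCA exprM -exprMn mulrA.
apply: (@log_deriv_inj _ k _ _ (\sum_(i < k) (p i)^`())) => //.
- apply: log_deriv_prod => i; apply: log_deriv_exp.
  by rewrite /p -mul_polyC dvdp_mull // dvdp_exp.
- have -> : \sum_(i < k) (p i)^`() =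
    \sum_v \sum_(i < k) ((-1) ^+ i * x v ^+ i.+1) *: 'X^i.
    rewrite exchange_big; apply: eq_bigr => i _ /=.
    rewrite -scaler_suml -mulr_sumr derivZ derivXn /= -scaler_nat scalerA.
    by rewrite mulfVK // pnatr_eq0.
  by apply: log_deriv_prod => v; apply: log_deriv_linear.
- rewrite -!horner_coef0 !horner_prod !big1 // => [v _|i _].
    by rewrite !hornerE.
  rewrite horner_sum big_ord_recl big1 => [|j _].
    by rewrite !hornerE fact0 invr1.
  by rewrite hornerZ horner_exp hornerZ hornerXn expr0n !mulr0 expr0n mulr0.
Qed.

(** * Sets of stubs of distinct vertices *)

Definition transversal_stubs {V : finType} (d : V -> nat) (T : {set stub d}) :
    bool :=
  [forall v, #|[set s in T | tag s == v]| <= 1]%N.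

Lemma card_stub {V : finType} (d : V -> nat) : #|stub d| = (\sum_v d v)%N.
Proof.
rewrite card_tagged sumnE big_map enumT; apply: eq_bigr => v _.
exact: card_ord.
Qed.

Lemma card_stub_of {V : finType} (d : V -> nat) (v : V) :
  #|[set s : stub d | tag s == v]| = d v.
Proof.
have stub_ofP (s : stub d) :
    tag s = v -> exists i : 'I_(d v), s = Tagged (fun w => 'I_(d w)) i.
  by case: s => w i /= <-; exists i.
pose stub_of (i : 'I_(d v)) : stub d := Tagged (fun w => 'I_(d w)) i.
have stub_of_inj : injective stub_of.
  by move=> i j /eqP; rewrite -tag_eqE /tag_eq /= eqxx tagged_asE => /eqP.
rewrite -[RHS]card_ord -cardsT -(card_imset _ stub_of_inj); apply: eq_card => s.
rewrite inE; apply/eqP/imsetP => [/stub_ofP[i ->]|[i _ ->] //].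
by exists i.
Qed.

(** Writing 1 + d v X as a sum over None and the stubs of v and expanding, each
    term of the product chooses at most one stub of each vertex. *)
Lemma coef_prod_card_transversal {R : fieldType} {V : finType} (d : V -> nat) k :
  (\prod_v (1 + (d v)%:R *: 'X : {poly R}))`_k =
  #|[set T : {set stub d} | transversal_stubs d T & #|T| == k]|%:R.
Proof.
(* F and G are inverse bijections between the choices f allowed by Q and the
   transversal sets T. *)
pose Q v (o : option (stub d)) := if o is Some s then tag s == v else true.
pose F (f : {ffun V -> option (stub d)}) := [set s | f (tag s) == Some s].
pose G (T : {set stub d}) : {ffun V -> option (stub d)} :=
  [ffun v => [pick s in T | tag s == v]].
have tagF f v s : f \in family Q -> f v = Some s -> tag s = v.
  by move=> /familyP /(_ v) + fv; rewrite fv => /eqP.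
have cardF f : f \in family Q -> #|F f| = (\sum_v isSome (f v))%N.
  move=> fQ; rewrite -sum1_card (partition_big (@tag V _) xpredT) //=.
  apply: eq_bigr => v _; case fv: (f v) => [s|] /=.
    rewrite (big_pred1 s) // => t /=; rewrite inE.
    apply/andP/eqP => [[/eqP + /eqP tv]| ->].
      by rewrite tv fv => -[].
    by rewrite (tagF _ _ _ fQ fv) fv.
  rewrite big_pred0 // => t; rewrite inE; apply/negP => /andP[/eqP + /eqP tv].
  by rewrite tv fv.
have trF f : transversal_stubs d (F f).
  apply/forallP => v; apply/card_le1P => s.
  rewrite !inE => /andP[/eqP fs /eqP sv] t.
  rewrite !inE; apply/andP/eqP => [[/eqP + /eqP tv]| ->].
    by rewrite tv -sv fs => -[].
  by rewrite fs sv !eqxx.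
have GF f : f \in family Q -> G (F f) = f.
  move=> fQ; apply/ffunP => v; rewrite ffunE; case: pickP => [s|nofib].
    by rewrite inE => /andP[/eqP + /eqP <-] => ->.
  case fv: (f v) => [s|] //; have := nofib s.
  by rewrite inE (tagF _ _ _ fQ fv) fv !eqxx.
have FG T : transversal_stubs d T -> F (G T) = T.
  move=> /forallP trT; apply/setP => s; rewrite inE ffunE.
  case: pickP => [t /andP[tT /eqP ts]|nofib].
    apply/eqP/idP => [[<-] //|sT]; congr Some.
    by apply: (card_le1_eqP (trT (tag s))); rewrite inE ?tT ?sT ?ts eqxx.
  by have := nofib s; rewrite eqxx andbT => ->.
have GQ T : G T \in family Q.
  by apply/familyP => v; rewrite ffunE; case: pickP => //= s /andP[].
have factor v : 1 + (d v)%:R *: 'X = \sum_(o | Q v o) 'X^(isSome o) :> {poly R}.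
  rewrite (bigD1 None) //= expr0; congr (_ + _).
  rewrite (eq_bigr (fun=> 'X)) => [|[] //].
  rewrite sumr_const scaler_nat; congr (_ *+ _).
  rewrite -{1}card_stub_of -(card_imset _ Some_inj); apply: eq_card => o.
  apply/imsetP/andP => [[s + ->] //|]; first by rewrite inE.
  by case: o => [s|] [] //= sv _; exists s; rewrite ?inE.
rewrite (eq_bigr _ (fun v _ => factor v)) bigA_distr_big_dep coef_sum.
rewrite -sum1_card natr_sum; under [RHS]eq_bigl do rewrite inE.
rewrite (eq_bigr (fun f => if #|F f| == k then 1 else 0)) => [|f fQ]; last first.
  by rewrite -expr_sum coefXn cardF // eq_sym; case: eqP.
rewrite -big_mkcondr /=.
rewrite (reindex_onto G F) => [|f /andP[fQ _]]; last exact: GF.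
apply: eq_bigl => T; rewrite GQ /=; apply/andP/andP => [[cT /eqP FGT]|[trT cT]].
  by rewrite -FGT trF FGT -{1}FGT.
by rewrite FG // eqxx cT.
Qed.

(** * The stubs received by a hyperedge *)

(** The permutation maps the list of A followed by its complement to the list of
    B followed by its complement, position by position. *)
Lemma perm_imset_eq {S : finType} (A B : {set S}) :
  #|A| = #|B| -> exists s : {perm S}, s @: A = B.
Proof.
move=> AB.
pose l (C : {set S}) := enum C ++ enum (~: C).
have l_uniq C : uniq (l C).
  rewrite cat_uniq !enum_uniq andbT /=; apply/hasPn => x.
  by rewrite !mem_enum inE.
have l_mem C x : x \in l C by rewrite mem_cat !mem_enum inE orbN.
have l_size C : size (l C) = #|S| by rewrite size_cat -!cardE cardsC.
pose f x := nth x (l B) (index x (l A)).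
have idx x : (index x (l A) < size (l B))%N.
  by rewrite l_size -(l_size A) index_mem.
have f_inj : injective f.
  move=> x y; rewrite /f (set_nth_default y) // => /eqP.
  by rewrite nth_uniq // => /eqP; apply: index_inj.
exists (perm f_inj); apply/eqP.
rewrite eqEcard card_imset ?AB ?leqnn ?andbT; last exact: perm_inj.
apply/subsetP => _ /imsetP[x xA ->]; rewrite permE /f.
have ixA : (index x (l A) < size (enum B))%N.
  by rewrite index_cat mem_enum xA -cardE -AB cardE index_mem mem_enum.
by rewrite nth_cat ixA -mem_enum mem_nth.
Qed.

Definition fiber {V E : finType} {d : V -> nat} (f : {ffun stub d -> E}) (e : E) :
    {set stub d} :=
  [set s | f s == e].

(** A permutation of the stubs that maps T to T' acts on the assignments. *)
Lemma card_fiber_eq {V E : finType} (d : V -> nat) (delta : E -> nat) (e : E)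
    (T T' : {set stub d}) : #|T| = #|T'| ->
  #|[set f in assignments d delta | fiber f e == T]| =
  #|[set f in assignments d delta | fiber f e == T']|.
Proof.
wlog suff: T T' / #|T| = #|T'| ->
  (#|[set f in assignments d delta | fiber f e == T]| <=
   #|[set f in assignments d delta | fiber f e == T']|)%N.
  by move=> le TT'; apply/eqP; rewrite eqn_leq !le.
move=> /perm_imset_eq[s sT].
pose h (f : {ffun stub d -> E}) := [ffun x => f ((s^-1)%g x)].
have h_inj : injective h.
  move=> f g /ffunP fg; apply/ffunP => x.
  by have := fg (s x); rewrite !ffunE permK.
have fiber_h f c : fiber (h f) c = s @: fiber f c.
  apply/setP => x; rewrite inE ffunE -{2}(permKV s x) mem_imset ?inE //.
  exact: perm_inj.
rewrite -(card_imset _ h_inj).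
apply/subset_leq_card/subsetP => _ /imsetP[f + ->].
rewrite !inE fiber_h => /andP[/forallP fA /eqP ->]; rewrite sT eqxx andbT.
apply/forallP => c; rewrite -/(fiber _ _) fiber_h card_imset ?fA //.
exact: perm_inj.
Qed.

(** The set of stubs received by e is uniform among the sets of size delta e. The
    statement is multiplied out, so that it also holds when there are no
    assignments or not enough stubs. *)
Lemma card_fiber_pred {V E : finType} (d : V -> nat) (delta : E -> nat) (e : E)
    (P : pred {set stub d}) :
  (#|[set f in assignments d delta | P (fiber f e)]| * 'C(\sum_v d v, delta e) =
   #|[set T : {set stub d} | P T & #|T| == delta e]| * #|assignments d delta|)%N.
Proof.
pose N T := #|[set f in assignments d delta | fiber f e == T]|.
have count (Q : pred {set stub d}) :
    #|[set f in assignments d delta | Q (fiber f e)]| =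
    (\sum_(T | Q T && (#|T| == delta e)) N T)%N.
  rewrite -sum1_card.
  rewrite (partition_big (fiber^~ e) (fun T => Q T && (#|T| == delta e))).
    apply: eq_bigr => T /andP[QT _]; rewrite /N -sum1_card.
    apply: eq_bigl => f; rewrite !inE -!andbA.
    by case: eqP => [->|]; rewrite ?QT ?andbF.
  by move=> f; rewrite !inE => /andP[/forallP fA ->]; rewrite fA.
have [T0 cT0|noT] := pickP (fun T : {set stub d} => #|T| == delta e);
  last first.
  have no0 : #|[set f in assignments d delta | P (fiber f e)]| = 0%N.
    by rewrite count big_pred0 // => T; rewrite noT andbF.
  rewrite no0 mul0n (_ : [set T : {set stub d} | _ & _] = set0).
    by rewrite cards0 mul0n.
  by apply/setP => T; rewrite !inE noT andbF.
have NT0 (Q : pred {set stub d}) :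
    #|[set f in assignments d delta | Q (fiber f e)]| =
    (#|[set T : {set stub d} | Q T & #|T| == delta e]| * N T0)%N.
  rewrite count -sum_nat_const; apply: eq_big => T; first by rewrite inE.
  by move=> /andP[_ /eqP cT]; apply: card_fiber_eq; rewrite cT (eqP cT0).
have := NT0 xpredT; rewrite card_draws card_stub => all.
rewrite NT0 -mulnA [(N T0 * _)%N]mulnC -all; congr (_ * #|pred_of_set _|)%N.
by apply/setP => f; rewrite !inE andbT.
Qed.

(** When the degrees have the same sum, the stubs are in bijection with the slots,
    the pairs of a hyperedge e and an index less than delta e. *)
Lemma assignments_gt0 {V E : finType} (d : V -> nat) (delta : E -> nat) :
  (\sum_v d v = \sum_e delta e)%N -> (0 < #|assignments d delta|)%N.
Proof.
(* The slots are also a type of stubs, with E in the role of the vertices. *)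
rewrite -!card_stub => card_eq.
pose g (x : stub d) : stub delta := enum_val (cast_ord card_eq (enum_rank x)).
have g_bij : bijective g.
  exists (fun y => enum_val (cast_ord (esym card_eq) (enum_rank y))) => x.
    by rewrite /g enum_valK cast_ordK enum_rankK.
  by rewrite /g enum_valK cast_ordKV enum_rankK.
apply/card_gt0P; exists [ffun x => tag (g x)]; rewrite inE; apply/forallP => e.
have -> : [set x | [ffun x => tag (g x)] x == e] = g @^-1: [set y | tag y == e].
  by apply/setP => x; rewrite !inE ffunE.
rewrite on_card_preimset ?card_stub_of //.
exact: onW_bij.
Qed.

(** * The expectation *)

(** For V empty the expectation is meaningless, but both sides are 0. *)
Lemma sum_uniform {R : numFieldType} {V : finType} (X : V -> R) :
  #|V|%:R * expect [set: V] X = \sum_v X v.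
Proof.
rewrite /expect cardsT; under eq_bigl do rewrite inE.
have [V0|V_gt0] := posnP #|V|; last by rewrite mulrC divfK // pnatr_eq0 -lt0n.
by rewrite V0 mul0r big_pred0 // => v; have := fintype0 v V0.
Qed.

(** Independence of the two coordinates of a uniform element of a product. *)
Lemma expect_setX {R : numFieldType} {S T : finType} (A : {set S}) (B : {set T})
    (X : S -> R) (Y : T -> R) :
  expect (setX A B) (fun p => X p.1 * Y p.2) = expect A X * expect B Y.
Proof.
rewrite /expect cardsX natrM invfM mulrACA; congr (_ * _).
rewrite mulr_suml; under [RHS]eq_bigr do rewrite mulr_sumr.
by rewrite pair_big; apply: eq_bigl => p; rewrite inE.
Qed.

Lemma degenerateE {V E : finType} {dout din : V -> nat}
    (H : {ffun stub dout -> E} * {ffun stub din -> E}) (e : E) :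
  degenerate H e = ~~ (transversal_stubs dout (fiber H.1 e)
                       && transversal_stubs din (fiber H.2 e)).
Proof.
have multE (d : V -> nat) (f : {ffun stub d -> E}) v :
    mult f e v = #|[set s in fiber f e | tag s == v]|.
  by apply: eq_card => s; rewrite !inE.
rewrite negb_and !negb_forall; apply/existsP/orP => [[v]|].
  rewrite !multE !(ltnNge 1).
  by case/orP=> ?; [left|right]; apply/existsP; exists v.
by case=> /existsP[v dv]; exists v; rewrite !multE !(ltnNge 1) dv ?orbT.
Qed.

(** There are 'C(M, k) sets of k stubs, of which e_k(d) consist of stubs of
    distinct vertices, where k = delta e and M is the number of stubs. *)
Lemma prob_transversal_fiber {R : numFieldType} {V E : finType}
    (d : V -> nat) (delta : E -> nat) (e : E) :
  (\sum_v d v = \sum_e delta e)%N ->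
  expect (assignments d delta) (fun f => (transversal_stubs d (fiber f e))%:R) =
  (delta e)`!%:R * (\sum_v d v - delta e)`!%:R / (\sum_v d v)`!%:R
  * signed_cycle_index (delta e) (fun i => \sum_v (d v)%:R ^+ i) :> R.
Proof.
move=> dE; have le_M : (delta e <= \sum_v d v)%N.
  by rewrite dE (bigD1 e) //= leq_addr.
have fact_neq0 m : m`!%:R != 0 :> R by rewrite pnatr_eq0 -lt0n fact_gt0.
have A_neq0 : #|assignments d delta|%:R != 0 :> R.
  by rewrite pnatr_eq0 -lt0n assignments_gt0.
have C_neq0 : 'C(\sum_v d v, delta e)%:R != 0 :> R.
  by rewrite pnatr_eq0 -lt0n bin_gt0.
rewrite signed_cycle_indexE coef_prod_card_transversal /expect.
have -> : \sum_(f in assignments d delta)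
    (transversal_stubs d (fiber f e))%:R =
    #|[set f in assignments d delta | transversal_stubs d (fiber f e)]|%:R :> R.
  rewrite -sum1_card natr_sum; under [RHS]eq_bigl do rewrite inE.
  by rewrite big_mkcondr; apply: eq_bigr => f _; case: ifP.
have /(congr1 (fun m => m%:R : R)) :=
  card_fiber_pred d delta e (transversal_stubs d).
rewrite !natrM => count; apply: (mulIf C_neq0).
rewrite mulrAC count mulfK // mulrAC -[LHS]mul1r; congr (_ * _).
rewrite -(bin_fact le_M) !natrM.
by field; rewrite C_neq0 !fact_neq0.
Qed.

Theorem theorem3 (R : archiRealFieldType) (V E : finType)
    (dout din : V -> nat) (dtail dhead : E -> nat)
    (hout : (\sum_(v : V) dout v = \sum_(e : E) dtail e)%N)
    (hin : (\sum_(v : V) din v = \sum_(e : E) dhead e)%N) :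
  let n : R := #|V|%:R in
  let EU (X : V -> R) : R := expect [set: V] X in
  expect (dihypergraphs dout din dtail dhead) (fun H => (DH H)%:R) =
  #|E|%:R -
  \sum_(e : E)
    ((dtail e)`!%:R * (dhead e)`!%:R
       * factr (n * EU (fun v => (dout v)%:R) - (dtail e)%:R)
       * factr (n * EU (fun v => (din v)%:R) - (dhead e)%:R)
     / (factr (n * EU (fun v => (dout v)%:R))
          * factr (n * EU (fun v => (din v)%:R))))
    * (\sum_(a in weighted_vectors (dtail e))
         (-1) ^+ (\sum_(i < dtail e) (i.+1 - 1) * a i)%N
         * \prod_(i < dtail e)
             (((a i)`!)%:R^-1
              * (n * EU (fun v => (dout v)%:R ^+ i.+1) / i.+1%:R) ^+ a i))
    * (\sum_(b in weighted_vectors (dhead e))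
         (-1) ^+ (\sum_(i < dhead e) (i.+1 - 1) * b i)%N
         * \prod_(i < dhead e)
             (((b i)`!)%:R^-1
              * (n * EU (fun v => (din v)%:R ^+ i.+1) / i.+1%:R) ^+ b i)).
Proof.
move=> n EU; pose A := dihypergraphs dout din dtail dhead.
pose simple (d : V -> nat) e (f : {ffun stub d -> E}) : R :=
  (transversal_stubs d (fiber f e))%:R.
have DHE H : (DH H)%:R =
    #|E|%:R - \sum_e simple dout e H.1 * simple din e H.2.
  rewrite /DH cardsE -sum1_card natr_sum big_mkcond /=.
  rewrite -[#|E|]sum1_card natr_sum -sumrB; apply: eq_bigr => e _.
  rewrite unfold_in -/(degenerate H e) degenerateE /simple.
  by case: (transversal_stubs dout _); case: (transversal_stubs din _);
     rewrite /= ?mulr0 ?mul0r ?mulr1 ?subrr ?subr0.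
have A_neq0 : #|A|%:R != 0 :> R.
  by rewrite cardsX pnatr_eq0 -lt0n muln_gt0 !assignments_gt0.
rewrite {1}/expect (eq_bigr _ (fun H _ => DHE H)) sumrB sumr_const.
rewrite -[#|E|%:R *+ _]mulr_natr.
rewrite mulrBl mulfK // exchange_big mulr_suml; congr (_ - _).
apply: eq_bigr => e _ /=; rewrite -/(expect A _) expect_setX.
rewrite !prob_transversal_fiber //.
have EUE X : n * EU X = \sum_v X v by exact: sum_uniform.
rewrite !EUE -!natr_sum.
have le_tail : (dtail e <= \sum_v dout v)%N.
  by rewrite hout (bigD1 e) //= leq_addr.
have le_head : (dhead e <= \sum_v din v)%N.
  by rewrite hin (bigD1 e) //= leq_addr.
rewrite -!natrB // !factr_nat invfM.
have powerE k (d : V -> nat) :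
    signed_cycle_index k (fun i => n * EU (fun v => (d v)%:R ^+ i)) =
    signed_cycle_index k (fun i => \sum_v (d v)%:R ^+ i).
  exact: eq_signed_cycle_index.
by move: (powerE (dtail e) dout) (powerE (dhead e) din);
   rewrite /signed_cycle_index => -> ->; ring.
Qed.
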